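(* If $G$ is a bipartite graph, then $\operatorname{hn}(G) = \operatorname{hn}(G_{C_4})$.
   Context: For an undirected graph $G$: $I_G(S)$ is the set of vertices lying on some shortest $u$–$v$ path with $u,v \in S$ (and $I_G(S)=S$ if $|S|\le 1$); $S$ is convex if $I_G(S)=S$; the hull of $S$ is the smallest convex set containing it; a hull set is a set whose hull is $V(G)$; $\operatorname{hn}(G)$ is the minimum size of a hull set. The same notions for an oriented graph $D$ are defined using directed geodesics (directed $(u,v)$-paths with minimum number of arcs, for all ordered pairs $u,v\in S$), giving $\operatorname{hn}(D)$. Given a graph $G$ with $V(G)=\{v_1,\dots,v_n\}$, $G_{C_4}$ is the oriented graph with vertex set $V(G) \cup \{v_{i,j}, v_{j,i} : v_iv_j \in E(G)\}$ and arc set $\{(v_i,v_{i,j}),(v_{i,j},v_j),(v_j,v_{j,i}),(v_{j,i},v_i) : v_iv_j \in E(G)\}$; i.e. each edge of $G$ is replaced by a directed $4$-cycle. *)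

(* Defs.v *)
From mathcomp Require Export all_boot.

Set Implicit Arguments.
Unset Strict Implicit.
Unset Printing Implicit Defensive.

(* A finite simple graph is a symmetric irreflexive [rel T] on a finType, an
   oriented graph an asymmetric one. The geodetic notions below only use ordered
   pairs and arcs; on a symmetric relation they are the undirected notions. *)
Section GeodesicConvexity.

Variables (V : finType) (d : rel V).

(* The (u,v)-path is the vertex sequence u :: p; it has [size p] arcs. *)
Definition is_path (u v : V) (p : seq V) : bool :=
  [&& path d u p, uniq (u :: p) & last u p == v].

(* A path has fewer than #|V| arcs, so bounded sequences cover all of them. *)
Definition geodesic (u v : V) (p : seq V) : bool :=
  is_path u v p && [forall q : #|V|.-bseq V, is_path u v q ==> (size p <= size q)].

(* u = v is allowed (trivial geodesic), so S is contained in I(S). *)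
Definition interval (S : {set V}) : {set V} :=
  [set x | [exists u in S, exists v in S, exists p : #|V|.-bseq V,
              geodesic u v p && (x \in u :: p)]].

Definition convex (S : {set V}) : bool := interval S == S.

Definition hull (S : {set V}) : {set V} :=
  \bigcap_(C : {set V} | convex C && (S \subset C)) C.

Definition hull_set (S : {set V}) : bool := hull S == [set: V].

Definition hn : nat := #|[arg min_(S < [set: V] | hull_set S) #|S|]|.

Lemma is_path_size u v p : is_path u v p -> size p < #|V|.
Proof.
case/and3P=> _ up _; have := max_card (mem (u :: p)).
by rewrite (card_uniqP up).
Qed.

Lemma geodesicP u v p :
  reflect (is_path u v p /\ forall q, is_path u v q -> size p <= size q)
          (geodesic u v p).
Proof.
apply: (iffP andP) => -[pP minp]; split=> //.
  move=> q qP.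
  by have /implyP/(_ qP) := forallP minp (Bseq (ltnW (is_path_size qP))).
by apply/forallP=> q; apply/implyP; apply: minp.
Qed.

Lemma intervalP (S : {set V}) x :
  reflect (exists u v p, [/\ u \in S, v \in S, geodesic u v p & x \in u :: p])
          (x \in interval S).
Proof.
rewrite inE; apply: (iffP idP) => [|[u [v [p [uS vS gp xp]]]]].
  case/exists_inP=> u uS /exists_inP[v vS /existsP[p /andP[gp xp]]].
  by exists u, v, p.
have sp : size p <= #|V| by case/andP: gp => /is_path_size/ltnW.
apply/exists_inP; exists u => //; apply/exists_inP; exists v => //.
by apply/existsP; exists (Bseq sp); rewrite gp.
Qed.

Lemma geodesic_refl u p : geodesic u u p = (p == [::]).
Proof.
apply/geodesicP/eqP => [[_ minp] | ->].
  by apply/eqP; rewrite -size_eq0 -leqn0 (minp [::]) // /is_path /= eqxx.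
by split=> //; rewrite /is_path /= eqxx.
Qed.

Lemma sub_interval (S : {set V}) : S \subset interval S.
Proof.
apply/subsetP=> x xS; apply/intervalP; exists x, x, [::].
by rewrite geodesic_refl mem_head.
Qed.

Lemma interval_small (S : {set V}) : #|S| <= 1 -> interval S = S.
Proof.
move/card_le1_eqP=> S1; apply/eqP; rewrite eqEsubset sub_interval andbT.
apply/subsetP=> x /intervalP[u [v [p [uS vS]]]].
by rewrite (S1 v u vS uS) geodesic_refl => /eqP-> /[!inE]/eqP->.
Qed.

Lemma intervalS (A B : {set V}) : A \subset B -> interval A \subset interval B.
Proof.
move/subsetP=> AB; apply/subsetP=> x /intervalP[u [v [p [uA vA gp xp]]]].
by apply/intervalP; exists u, v, p; split=> //; apply: AB.
Qed.

Lemma sub_hull (S : {set V}) : S \subset hull S.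
Proof. by apply/bigcapsP=> C /andP[]. Qed.

Lemma hull_min (S C : {set V}) : convex C -> S \subset C -> hull S \subset C.
Proof. by move=> cC sC; apply: bigcap_inf; rewrite cC. Qed.

Lemma convex_hull (S : {set V}) : convex (hull S).
Proof.
rewrite /convex eqEsubset sub_interval andbT.
apply/bigcapsP=> C /andP[cC sC]; rewrite -(eqP cC).
exact/intervalS/hull_min.
Qed.

Lemma hull_setT : hull_set [set: V].
Proof. by rewrite /hull_set -subTset sub_hull. Qed.

Lemma hnP :
  (exists2 S, hull_set S & #|S| = hn) /\ (forall S, hull_set S -> hn <= #|S|).
Proof.
rewrite /hn; case: arg_minnP => [|S hS minS]; first exact: hull_setT.
by split=> //; exists S.
Qed.

End GeodesicConvexity.

Definition bipartite (T : finType) (e : rel T) : Prop :=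
  exists A : {set T}, forall x y, e x y -> (x \in A) != (y \in A).

Section C4Replacement.

Variables (T : finType) (e : rel T).

(* [inl v_i] is v_i; [inr (v_i, v_j)], for an ordered pair of adjacent
   vertices, is v_{i,j}. *)
Definition C4_vertex : finType := (T + {p : T * T | e p.1 p.2})%type.

Definition C4_arc : rel C4_vertex := fun a b =>
  match a, b with
  | inl x, inr p => x == (val p).1
  | inr p, inl y => (val p).2 == y
  | _, _ => false
  end.

Lemma C4_arc_oriented : irreflexive e ->
  forall a b, C4_arc a b -> ~~ C4_arc b a.
Proof.
move=> irr [x|[[u v] /= uv]] [y|[[u' v'] /= uv']] //=.
  by move/eqP=> ->; apply: contraTneq uv' => ->; rewrite irr.
by move/eqP=> <-; apply: contraTneq uv => ->; rewrite irr.
Qed.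

End C4Replacement.

Arguments C4_arc {T} e.

(* Main.v *)
Require Import Defs.
From mathcomp Require Import all_boot.

(** Projecting a directed walk of [G_{C_4}] to [G] halves its length, so
    geodesics of [G_{C_4}] between original vertices are exactly the lifts of
    geodesics of [G], and every hull set of [G] is one of [G_{C_4}].
    Conversely, given a hull set [S] of [G_{C_4}], replace every [v_{i,j}] in
    [S] by one of [v_i], [v_j], choosing the endpoints so that the sum of the
    pairwise distances is maximal. Distances from the two ends of an edge to a
    third vertex differ by exactly one in a bipartite graph, so by maximality
    the discarded end is closer than the chosen one to some other chosen
    vertex, and hence lies on a geodesic between chosen vertices. *)

(** * Geodesics as shortest walks, and convexity *)

Section Geodesics.

Variables (V : finType) (d : rel V).

(** Any walk shortens to a path inside its own vertex set, so minimality among paths extends to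
    walks; a shortest walk repeats no vertex, since its shortening would be strictly shorter. *)
Lemma geodesic_walkP (u v : V) (p : seq V) :
  reflect [/\ path d u p, last u p = v
            & forall q, path d u q -> last u q = v -> size p <= size q]
          (geodesic d u v p).
Proof.
apply: (iffP (geodesicP d u v p)) => [[/and3P[pp up /eqP lp] minp] | [pp lp minp]].
  split=> // q pq; case/shortenP: pq => q' pq' uq' sq' lq'.
  have /andP[_ /uniq_leq_size/(_ sq')] := uq'; apply: leq_trans.
  by apply: minp; rewrite /is_path pq' uq' lq' eqxx.
split; last by move=> q /and3P[pq _ /eqP]; apply: minp.
rewrite /is_path pp lp eqxx andbT.
move: lp minp; case/shortenP: (pp) => p' pp' up' sp' lp' /(_ _ pp' lp') le_pp'.
apply: (leq_size_uniq up') => [y|]; last exact: le_pp'.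
by rewrite !inE => /predU1P[->|/sp'->]; rewrite ?eqxx ?orbT.
Qed.

Lemma geodesic_cat {u v : V} {p1 p2 : seq V} : geodesic d u v (p1 ++ p2) ->
  geodesic d u (last u p1) p1 /\ geodesic d (last u p1) v p2.
Proof.
move=> /geodesic_walkP[]; rewrite cat_path last_cat => /andP[pp1 pp2] lp minp.
split; apply/geodesic_walkP; split=> // q pq lq.
  have := minp (q ++ p2); rewrite cat_path last_cat lq pq pp2 lp !size_cat.
  by move=> /(_ isT erefl); rewrite leq_add2r.
have := minp (p1 ++ q); rewrite cat_path last_cat pp1 pq lq !size_cat.
by move=> /(_ isT erefl); rewrite leq_add2l.
Qed.

Lemma convexP (C : {set V}) :
  (forall u v p, u \in C -> v \in C -> geodesic d u v p -> {subset p <= C}) ->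
  convex d C.
Proof.
move=> CP; rewrite /convex eqEsubset sub_interval andbT.
apply/subsetP=> x /intervalP[u [v [p [uC vC gp]]]].
by rewrite inE => /predU1P[-> | /(CP u v p uC vC gp)].
Qed.

Lemma convex_geodesic {C : {set V}} {u v p} :
  convex d C -> u \in C -> v \in C -> geodesic d u v p -> {subset p <= C}.
Proof.
move=> /eqP cC uC vC gp x xp; rewrite -cC; apply/intervalP.
by exists u, v, p; rewrite inE xp orbT.
Qed.

(** * Distance, in symmetric and bipartite graphs *)

Definition has_walk (u v : V) (n : nat) : bool :=
  [exists t : n.-tuple V, path d u t && (last u t == v)].

(* Equal to [#|V|] when [v] is not reachable from [u]. *)
Definition dist (u v : V) : nat := find (has_walk u v) (iota 0 #|V|).

Lemma dist_le (u : V) (p : seq V) : path d u p -> dist u (last u p) <= size p.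
Proof.
case/shortenP=> q pq uq sub_qp.
have /andP[_ /uniq_leq_size/(_ sub_qp)] := uq; apply: leq_trans.
have lt_q : size q < #|V|.
  by apply: (@is_path_size _ d u (last u q)); rewrite /is_path pq uq eqxx.
rewrite leqNgt; apply/negP=> /(before_find 0).
rewrite nth_iota // => /existsP[]; exists (in_tuple q).
by rewrite pq eqxx.
Qed.

Lemma dist_xx (u : V) : dist u u = 0.
Proof. by apply/eqP; rewrite -leqn0 (dist_le u [::]). Qed.

Lemma distP {u v : V} : connect d u v ->
  exists p, [/\ path d u p, last u p = v & size p = dist u v].
Proof.
case/connectP=> q0 pq0 lq0.
have : has (has_walk u v) (iota 0 #|V|).
  case/shortenP: pq0 lq0 => q pq uq _ ->; apply/hasP; exists (size q).
    by rewrite mem_iota (@is_path_size _ d u (last u q)) // /is_path pq uq eqxx.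
  by apply/existsP; exists (in_tuple q); rewrite pq eqxx.
move=> hw; have := hw; rewrite has_find size_iota => lt_f.
have := nth_find 0 hw; rewrite nth_iota // add0n.
by case/existsP=> t /andP[pt /eqP lt]; exists t; rewrite size_tuple.
Qed.

Lemma dist_disconnected (u v : V) : ~~ connect d u v -> dist u v = #|V|.
Proof.
move=> nuv; rewrite /dist hasNfind ?size_iota //.
apply: contra nuv => /hasP[n _ /existsP[t /andP[pt /eqP lt]]].
by apply/connectP; exists t.
Qed.

Hypothesis d_sym : symmetric d.

Lemma dist_sym (u v : V) : dist u v = dist v u.
Proof.
have csym : connect_sym d := sym_connect_sym d_sym.
suff le x y : connect d x y -> dist y x <= dist x y.
  have [uv|nuv] := boolP (connect d u v).
    by apply/eqP; rewrite eqn_leq !le // csym.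
  by rewrite !dist_disconnected // csym.
case/distP=> p [pp <- <-].
have := dist_le (last x p) (rev (belast x p)).
rewrite rev_path (@eq_path _ _ d) // => /(_ pp).
rewrite size_rev size_belast.
by case: (p) => [|z q] //=; rewrite rev_cons last_rcons.
Qed.

Lemma dist_step (x y w : V) : d x y -> dist x w <= (dist y w).+1.
Proof.
move=> dxy; have [/distP[p [pp <- <-]]|nyw] := boolP (connect d y w).
  by apply: (dist_le x (y :: p)); rewrite /= dxy.
rewrite !dist_disconnected // (contra _ nyw) //; apply: connect_trans.
by apply: connect1; rewrite d_sym.
Qed.

Hypothesis d_bip : bipartite d.

(** Each arc changes sides, so the ends of a walk fix the parity of its length, and [x] and [y] lie
    on opposite sides. *)
Lemma bipartite_dist_neq (x y w : V) :
  d x y -> connect d y w -> dist x w != dist y w.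
Proof.
have [A AP] := d_bip => dxy yw.
have parity p u : path d u p -> (last u p \in A) = (u \in A) (+) odd (size p).
  elim: p u => [|v p IHp] u /=; first by rewrite addbF.
  case/andP=> /AP + /IHp->.
  by case: (u \in A); case: (v \in A); case: odd.
have /distP[p [pp lp <-]] := connect_trans (connect1 dxy) yw.
have /distP[q [pq lq <-]] := yw.
apply/eqP=> pq_size; have := AP _ _ dxy; have := parity _ _ pp; have := parity _ _ pq.
by rewrite lp lq pq_size => ->; case: (x \in A); case: (y \in A); case: odd.
Qed.

(** If [x] were nearer to [w] than [y] is, the arc from [y] to [x] followed by a shortest walk to
    [w] would be a geodesic between members of [C], forcing [x] into [C]. Equal distances are
    excluded by parity. *)
Lemma convex_step (C : {set V}) (x y w : V) : convex d C ->
  y \in C -> w \in C -> d x y -> connect d y w -> x \notin C ->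
  dist x w = (dist y w).+1.
Proof.
move=> cC yC wC dxy yw xC.
have := dist_step _ _ w dxy; have := bipartite_dist_neq _ _ _ dxy yw.
move=> ne le; apply/eqP; rewrite eqn_leq le ltn_neqAle eq_sym ne leqNgt /=.
apply: contra xC => lt_xy; have dyx : d y x by rewrite d_sym.
have := connect_trans (connect1 dxy) yw => /distP[p [pp lp sp]].
apply: (convex_geodesic (p := x :: p) cC yC wC _ _ (mem_head _ _)).
apply/geodesic_walkP; split=> [||q pq lq]; rewrite /= ?dyx //.
by rewrite sp; apply: leq_trans lt_xy _; rewrite -lq dist_le.
Qed.

End Geodesics.

Arguments geodesic_walkP {V d u v p}.
Arguments geodesic_cat {V d u v p1 p2}.
Arguments convex_geodesic {V d C u v p}.
Arguments dist {V} d u v.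

(** * Walks and convex sets of [G_{C_4}] against those of [G] *)

Section C4.

Variables (T : finType) (e : rel T).

Local Notation V4 := (C4_vertex e).
Local Notation arc := (C4_arc e).

Definition mid {x y : T} (xy : e x y) : V4 :=
  inr (Sub (x, y) (xy : e (x, y).1 (x, y).2)).

Definition originals (p : seq V4) : seq T :=
  pmap (fun a : V4 => if a is inl x then Some x else None) p.

Definition C4_ends (H : {set T}) : {set V4} :=
  [set a : V4 | match a with
           | inl x => x \in H
           | inr p => ((val p).1 \in H) && ((val p).2 \in H)
           end].

Lemma C4_walk_lift (u : T) (q : seq T) : path e u q ->
  exists p, [/\ path arc (inl u) p, last (inl u) p = inl (last u q),
                size p = (size q).*2 & {subset [seq inl x | x <- q] <= p}].
Proof.
elim: q u => [|v q IHq] u /=; first by exists [::].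
case/andP=> uv /IHq[p [pp lp sp subp]]; exists (mid uv :: inl v :: p).
split=> //=; rewrite ?sp ?eqxx // => x; rewrite !inE.
by case/predU1P=> [->|/subp->]; rewrite ?eqxx ?orbT.
Qed.

(** Arcs alternate between original vertices and midpoints [v_{i,j}], so the induction removes two
    arcs at a time. The last clause holds because each midpoint sits between two consecutive
    originals of the walk. *)
Lemma C4_walk_proj (u v : T) (p : seq V4) :
  path arc (inl u) p -> last (inl u) p = inl v ->
  [/\ path e u (originals p), last u (originals p) = v,
      size p = (size (originals p)).*2 &
      forall H : {set T}, u \in H -> {subset originals p <= H} ->
      {subset p <= C4_ends H}].
Proof.
have [n] := ubnP (size p); elim: n p u => // n IHn [|a [|b p]] u.
- by move=> _ _ [->]; split.
- by case: a.
case: a => [//|[[x y] /= xy]]; case: b => [z|b] /= szp; last by rewrite andbF.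
case/and3P=> /eqP ux /eqP yz pp lp; subst x z.
have [|pq lq sq subq] := IHn p y _ pp lp; first exact: ltnW.
split; rewrite /= ?xy ?sq // => H uH subH a.
have yH : y \in H by apply: subH; rewrite mem_head.
rewrite !inE => /or3P[/eqP->|/eqP->|ap] //=; first by rewrite uH yH.
suff: a \in C4_ends H by rewrite inE.
by apply: (subq H yH) ap => z zp; apply: subH; rewrite inE zp orbT.
Qed.

Lemma geodesic_originals (u v : T) (p : seq V4) :
  geodesic arc (inl u) (inl v) p -> geodesic e u v (originals p).
Proof.
case/geodesic_walkP=> pp lp minp; have [pq lq sq _] := C4_walk_proj _ _ _ pp lp.
apply/geodesic_walkP; split=> // q /C4_walk_lift[p' [pp' lp' sp' _]] lqv.
by rewrite -leq_double -sq -sp'; apply: minp; rewrite ?lp' ?lqv.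
Qed.

Lemma geodesic_lift (u v : T) (q : seq T) : geodesic e u v q ->
  exists2 p, geodesic arc (inl u) (inl v) p & {subset [seq inl x | x <- q] <= p}.
Proof.
case/geodesic_walkP=> /C4_walk_lift[p [pp lp sp subp]] lq minq; exists p => //.
apply/geodesic_walkP; rewrite lp lq; split=> // p' pp' lp'.
have [pq' lq' -> _] := C4_walk_proj _ _ _ pp' lp'.
by rewrite sp leq_double minq.
Qed.

Lemma convex_originals (C : {set V4}) :
  convex arc C -> convex e [set x | inl x \in C].
Proof.
move=> cC; apply: convexP => u v q; rewrite !inE => uC vC /geodesic_lift[p gp subp] x xq.
by rewrite inE (convex_geodesic cC uC vC gp) // subp // map_f.
Qed.

Lemma hull_set_lift (S : {set T}) :
  irreflexive e -> hull_set e S -> hull_set arc (inl @: S).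
Proof.
move=> e_irr /eqP hS; rewrite /hull_set -subTset.
have cH := convex_hull arc (inl @: S); set H := hull arc _ in cH *.
have inH x : inl x \in H.
  suff /subsetP/(_ x) : hull e S \subset [set x | inl x \in H] by rewrite hS !inE; apply.
  apply: hull_min (convex_originals _ cH) _; apply/subsetP=> y yS.
  by rewrite inE (subsetP (sub_hull _ _)) ?imset_f.
(* All original vertices are in [H]; the midpoint of [x] and [y] is on the two-arc geodesic joining
   them. *)
apply/subsetP=> -[x|[[x y] /= xy]] _ //.
apply: (convex_geodesic (p := [:: mid xy; inl y]) cH (inH x) (inH y)); last exact: mem_head.
apply/geodesic_walkP; split=> //=; rewrite ?eqxx //.
case=> [|[//|a] [|b q]] //= _ [xyE].
by have := xy; rewrite xyE e_irr.
Qed.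

(** A midpoint has a single in-neighbour and a single out-neighbour, both in [H] if the midpoint is
    in [C4_ends H]. Trimming the end arcs at midpoints thus reduces to geodesics between originals
    in [H], which project to [G]. *)
Lemma convex_C4_ends (H : {set T}) : convex e H -> convex arc (C4_ends H).
Proof.
move=> cH; apply: convexP.
have ll u v p : u \in H -> v \in H ->
    geodesic arc (inl u) (inl v) p -> {subset p <= C4_ends H}.
  move=> uH vH gp; have /geodesic_walkP[pp lp _] := gp.
  have [_ _ _] := C4_walk_proj _ _ _ pp lp; apply=> //.
  exact: convex_geodesic cH uH vH (geodesic_originals _ _ _ gp).
have lr u v p : u \in H -> v \in C4_ends H ->
    geodesic arc (inl u) v p -> {subset p <= C4_ends H}.
  case: v => [v|q] uH vC gp; first by rewrite inE in vC; apply: ll gp.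
  case/lastP: p gp => [|p a] // gp.
  have /geodesic_walkP[+ + _] := gp; rewrite rcons_path last_rcons => /andP[_ + aE].
  rewrite -cats1 in gp; have [{}gp _] := geodesic_cat gp; rewrite {a}aE.
  case lpE : (last _ p) gp => [z|//] gp /= /eqP zE b; subst z.
  rewrite mem_rcons inE => /predU1P[->//|]; apply: ll gp b => //.
  by move: vC; rewrite inE => /andP[].
move=> [u|q] v [|a p] uC vC // gp; first by rewrite inE in uC; apply: lr gp.
have /geodesic_walkP[/= /andP[+ _] _ _] := gp.
case: a gp => [z|//] gp /= /eqP zE; subst z.
have [_ {}gp] := geodesic_cat (p1 := [:: _]) gp.
have yH : (val q).2 \in H by move: uC; rewrite inE => /andP[].
by move=> b; rewrite inE => /predU1P[->|]; [rewrite inE | apply: lr gp b].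
Qed.

(** * Replacing midpoints by endpoints *)

Definition endpoint (b : bool) (a : V4) : T :=
  match a with
  | inl x => x
  | inr p => if b then (val p).1 else (val p).2
  end.

Hypothesis e_sym : symmetric e.

Let e_csym : connect_sym e := sym_connect_sym e_sym.

Lemma edge_endpoint (b : bool) (p : {p : T * T | e p.1 p.2}) :
  e (endpoint (~~ b) (inr p)) (endpoint b (inr p)).
Proof. by case: b; case: p => -[x y] /= //; rewrite e_sym. Qed.

Lemma connect_endpoint (b c : bool) (a : V4) : connect e (endpoint b a) (endpoint c a).
Proof.
case: a => [x|p]; first exact: connect0.
have [->|] := eqVneq b c; first exact: connect0.
rewrite -negb_add negbK => /eqP bc.
by apply: connect1; have := edge_endpoint c p; case: b c bc => [] [].
Qed.

Lemma C4_arc_connect (a b : V4) : arc a b -> connect e (endpoint true a) (endpoint true b).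
Proof.
case: a b => [x|p] [y|q] //= /eqP <-; first exact: connect0.
by rewrite connect1 // (valP p).
Qed.

Lemma C4_path_connect (a : V4) (p : seq V4) :
  path arc a p -> {in p, forall b, connect e (endpoint true a) (endpoint true b)}.
Proof.
elim: p a => [|c p IHp] a //= /andP[/C4_arc_connect ac /IHp cp] b.
by rewrite inE => /predU1P[->//|/cp]; apply: connect_trans.
Qed.

(** Otherwise [inr p], together with all other components, would be a convex set [K] containing [S]
    but missing an end of [p]. The vertex [t] later supplies the pair whose distance strictly
    grows. *)
Lemma hull_set_connected (S : {set V4}) (p : {p : T * T | e p.1 p.2}) :
  hull_set arc S -> inr p \in S ->
  exists t, [/\ t \in S, t != inr p
               & connect e (endpoint true (inr p)) (endpoint true t)].
Proof.
move=> /eqP hS pS; set z := endpoint true (inr p).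
have [/existsP[t /and3P[]]|] :=
  boolP [exists t, [&& t \in S, t != inr p & connect e z (endpoint true t)]].
  by exists t.
rewrite negb_exists => /forallP none.
pose K := [set a : V4 | (a == inr p) || ~~ connect e z (endpoint true a)].
suff cK : convex arc K.
  have : inl z \in K.
    suff SK : S \subset K by apply: (subsetP (hull_min cK SK)); rewrite hS inE.
    apply/subsetP=> a aS; have := none a; rewrite aS /= negb_and negbK inE.
    by case/orP=> ->; rewrite ?orbT.
  by rewrite inE /= connect0.
apply: convexP => u v q uK vK gq a aq; have /geodesic_walkP[pq lq _] := gq.
have ua := C4_path_connect _ _ pq _ aq.
have uv : connect e (endpoint true u) (endpoint true v).
  rewrite -lq; case: (q) pq => [|c r] pr;
  by rewrite ?connect0 // (C4_path_connect _ _ pr) /= ?mem_last.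
(* A geodesic meeting the component of [z] has both ends there, hence both equal to [inr p], so it
   is trivial. *)
rewrite inE; apply/orP; right; apply/negP=> za.
have zu : connect e z (endpoint true u) by rewrite (connect_trans za) // e_csym.
move: uK vK gq; rewrite !inE zu (connect_trans zu uv) !orbF => /eqP-> /eqP->.
by rewrite geodesic_refl => /eqP qE; rewrite qE in aq.
Qed.

Hypothesis e_bip : bipartite e.

Lemma hull_set_endpoints (S : {set V4}) : hull_set arc S ->
  exists2 S' : {set T}, hull_set e S' & #|S'| <= #|S|.
Proof.
move=> hS.
pose g (f : {ffun V4 -> bool}) a := endpoint (f a) a.
pose F f := \sum_(p | (p.1 \in S) && (p.2 \in S)) dist e (g f p.1) (g f p.2).
case: (@arg_maxnP _ [ffun=> true] predT F) => // f _ maxf.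
exists (g f @: S); last exact: leq_imset_card.
have cH := convex_hull e (g f @: S); rewrite /hull_set; set H := hull e _ in cH *.
have gH a : a \in S -> g f a \in H.
  by move=> aS; apply: (subsetP (sub_hull _ _)); apply: imset_f.
suff SH : S \subset C4_ends H.
  have := hull_min (convex_C4_ends _ cH) SH; rewrite (eqP hS) => /subsetP TH.
  by rewrite -subTset; apply/subsetP=> x _; have := TH (inl x); rewrite !inE; apply.
apply/subsetP=> -[x xS|p pS]; first by rewrite inE; apply: gH xS.
suff: endpoint (~~ f (inr p)) (inr p) \in H.
  by have := gH _ pS; rewrite /g inE /=; case: (f _) => /= -> ->.
(* If the discarded end [z'] is outside [H], flipping the choice at [inr p] alone will increase [F],
   against maximality of [f]. *)
apply/negPn/negP=> nH; set z' := endpoint _ _ in nH.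
pose f' := [ffun a => if a == inr p then ~~ f (inr p) else f a].
have gf' a : g f' a = if a == inr p then z' else g f a.
  by rewrite /g ffunE; case: eqP => // ->.
have zz' : e z' (g f (inr p)) := edge_endpoint _ _.
have step t : t \in S -> connect e (g f (inr p)) (g f t) ->
    dist e z' (g f t) = (dist e (g f (inr p)) (g f t)).+1.
  by move=> tS ct; apply: (convex_step _ _ e_sym e_bip H); rewrite ?gH.
(* In another component both distances take the same default value. *)
have step_le t : t \in S -> dist e (g f (inr p)) (g f t) <= dist e z' (g f t).
  move=> tS; have [/(step _ tS)->//|nt] := boolP (connect e (g f (inr p)) (g f t)).
  rewrite !dist_disconnected //; apply: contra nt.
  by apply: connect_trans; rewrite connect1 // e_sym.
have [t [tS tp ct]] := hull_set_connected _ _ hS pS.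
have {}ct : connect e (g f (inr p)) (g f t).
  apply: connect_trans (connect_endpoint _ true _) _.
  exact: (connect_trans ct (connect_endpoint _ _ _)).
have := maxf f' isT; apply/negP; rewrite -ltnNge /F.
pose pt : V4 * V4 := (inr p, t).
have ptS : (pt.1 \in S) && (pt.2 \in S) by rewrite pS tS.
(* The pair [pt] gains one and no other pair loses; the pair of [inr p] with itself contributes 0
   before and after. *)
rewrite (bigD1 pt ptS) [ltnRHS](bigD1 pt ptS) -addSn leq_add //.
  by rewrite !gf' eqxx (negPf tp) -step.
apply: leq_sum => -[a b] /= /andP[/andP[aS bS] _]; rewrite !gf'.
case: eqP => [->|_]; case: eqP => [->|_] //; rewrite ?dist_xx ?step_le //.
by rewrite !(dist_sym _ _ e_sym (g f a)) step_le.
Qed.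

End C4.

Theorem theorem5 (T : finType) (e : rel T)
  (e_sym : symmetric e) (e_irr : irreflexive e) (e_bip : bipartite e) :
  hn e = hn (C4_arc e).
Proof.
have [[S hS cS] minG] := hnP e; have [[S4 hS4 cS4] minC] := hnP (C4_arc e).
apply/eqP; rewrite eqn_leq; apply/andP; split.
  have [S' hS' leS'] := hull_set_endpoints _ _ e_sym e_bip _ hS4.
  by rewrite -cS4; apply: leq_trans (minG _ hS') leS'.
by rewrite -cS; apply: leq_trans (minC _ (hull_set_lift _ _ _ e_irr hS)) (leq_imset_card _ _).
Qed.
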